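(* Let $A\in\mathbb{C}^{n\times n}$ be nonsingular with $2\times2$ block structure $A=\begin{bmatrix} A_{11} & A_{12} \\ A_{21} & A_{22} \end{bmatrix}$, $A_{ij}\in\mathbb{C}^{n_i\times n_j}$, $n_1+n_2=n$, $n_1,n_2\ge1$. Let $b,x^{(0)}\in\mathbb{C}^n$, $r^{(0)}=b-Ax^{(0)}$, and let $g(r^{(0)})$ be the grade of $r^{(0)}$ with respect to $A$. Then: (i) [Finite termination] There exists an index $k_{\max}\le g(r^{(0)})$ such that $A^{-1}r^{(0)}\in\mathcal{K}^{(k_{\max})}_\times(A,r^{(0)})$, and if $H^{(k_{\max})}_\times$ is nonsingular, then the QFOM iterate $x^{(k_{\max})}_{\mathrm{qfom}}$ exists and $x^{(k_{\max})}_{\mathrm{qfom}}=A^{-1}b$. (ii) [Quadratic numerical range property] The inclusion $W^2(H^{(k)}_\times)\subseteq W^2(A)$ holds for $k=1,\ldots,k_{\max}$, where $H^{(k)}_\times$ carries the $2\times 2$ block structure given in the context. (iii) [Existence] If $0\notin W^2(A)$, then $x^{(k)}_{\mathrm{qfom}}$ exists for $k=1,\ldots,k_{\max}$, i.e. $H^{(k)}_\times$ is nonsingular for all $k=1,\ldots,k_{\max}$.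
   Context: For a matrix $M=\begin{bmatrix} M_{11} & M_{12} \\ M_{21} & M_{22} \end{bmatrix}$ with $M_{ij}\in\mathbb{C}^{m_i\times m_j}$, the quadratic numerical range (with respect to this block structure) is $$W^2(M)=\bigcup_{x_1\in\mathbb{C}^{m_1},\,x_2\in\mathbb{C}^{m_2},\,\|x_1\|=\|x_2\|=1}\operatorname{spec}\begin{bmatrix} x_1^*M_{11}x_1 & x_1^*M_{12}x_2 \\ x_2^*M_{21}x_1 & x_2^*M_{22}x_2 \end{bmatrix},$$ where $\operatorname{spec}$ is the set of eigenvalues and $\|\cdot\|$ is the Euclidean norm. Krylov subspace: $\mathcal{K}^{(k)}(A,v)=\operatorname{span}\{v,Av,\ldots,A^{k-1}v\}$. The grade $g(v)$ of $v$ with respect to $A$ is the first index $g$ with $\mathcal{K}^{(g)}(A,v)=\mathcal{K}^{(g+1)}(A,v)$. Let $\mathcal{K}^{(k)}_1(A,r^{(0)})\subseteq\mathbb{C}^{n_1}$ and $\mathcal{K}^{(k)}_2(A,r^{(0)})\subseteq\mathbb{C}^{n_2}$ be the projections of $\mathcal{K}^{(k)}(A,r^{(0)})$ onto the first $n_1$ and the last $n_2$ components, with dimensions $d_1^{(k)}$ and $d_2^{(k)}$ (which may be less than $k$), and let $\mathcal{K}^{(k)}_\times(A,r^{(0)})=\mathcal{K}^{(k)}_1(A,r^{(0)})\times\mathcal{K}^{(k)}_2(A,r^{(0)})\subseteq\mathbb{C}^n$. Let $V_i^{(k)}\in\mathbb{C}^{n_i\times d_i^{(k)}}$ be a matrix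 whose columns form an orthonormal basis of $\mathcal{K}^{(k)}_i(A,r^{(0)})$, $i=1,2$, and set $$V^{(k)}_\times=\begin{bmatrix} V_1^{(k)} & 0 \\ 0 & V_2^{(k)} \end{bmatrix},\qquad H^{(k)}_\times=(V_\times^{(k)})^*AV_\times^{(k)}=\begin{bmatrix} (V_1^{(k)})^*A_{11}V_1^{(k)} & (V_1^{(k)})^*A_{12}V_2^{(k)} \\ (V_2^{(k)})^*A_{21}V_1^{(k)} & (V_2^{(k)})^*A_{22}V_2^{(k)} \end{bmatrix}.$$ The $k$-th QFOM iterate $x^{(k)}_{\mathrm{qfom}}$ is defined by $x^{(k)}_{\mathrm{qfom}}\in x^{(0)}+\mathcal{K}^{(k)}_\times(A,r^{(0)})$ and $b-Ax^{(k)}_{\mathrm{qfom}}\perp\mathcal{K}^{(k)}_\times(A,r^{(0)})$. If $H^{(k)}_\times$ is nonsingular, it exists and equals $x^{(0)}+V_\times^{(k)}(H_\times^{(k)})^{-1}(V_\times^{(k)})^*r^{(0)}$; if $H^{(k)}_\times$ is singular, the $k$-th QFOM iterate is said not to exist.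
   Formalization: In (iii), existence is claimed only for those k at which the projected Krylov space K_i^(k) is nonzero whenever n_i = 1 (i = 1,2); otherwise it can fail, e.g. A = [0 1; 1 0], n_1 = n_2 = 1, r^(0) = (0,1)^T, k = 1. *)

(* Defs.v *)
From HB Require Import structures.
From mathcomp Require Import all_boot all_order all_algebra.
From mathcomp Require Import complex.
From mathcomp Require Import classical_sets reals.

Set Implicit Arguments.
Unset Strict Implicit.
Unset Printing Implicit Defensive.

Import Order.TTheory GRing.Theory Num.Theory.

Local Open Scope classical_set_scope.
Local Open Scope ring_scope.
Local Open Scope sesquilinear_scope.

(* The default norm on matrices in mathcomp-analysis is the sup norm, hence an
   explicit Euclidean norm; it takes values in C, as [`|z|] does. *)
Definition enorm (C : numClosedFieldType) m (x : 'cV[C]_m) : C :=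
  sqrtC (\sum_(i < m) `|x i ord0| ^+ 2).

Definition compress2 (C : numClosedFieldType) m1 m2 (M : 'M[C]_(m1 + m2))
    (x1 : 'cV[C]_m1) (x2 : 'cV[C]_m2) : 'M[C]_(1 + 1) :=
  block_mx (x1 ^t* *m ulsubmx M *m x1) (x1 ^t* *m ursubmx M *m x2)
           (x2 ^t* *m dlsubmx M *m x1) (x2 ^t* *m drsubmx M *m x2).

(* The block structure of [M] is read off its type 'M_(m1 + m2). If m1 = 0 or
   m2 = 0 there are no unit vectors on that side and the set is empty. *)
Definition qnr (C : numClosedFieldType) m1 m2 (M : 'M[C]_(m1 + m2)) : set C :=
  [set z | exists x1 : 'cV[C]_m1, exists x2 : 'cV[C]_m2,
     [/\ enorm x1 = 1, enorm x2 = 1 & eigenvalue (compress2 M x1 x2) z]].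

Definition krylov (C : numClosedFieldType) n (A : 'M[C]_n) (v : 'cV[C]_n)
    (k : nat) : {vspace 'cV[C]_n} :=
  <<[seq A ^+ i *m v | i <- iota 0 k]>>%VS.

Lemma krylov_stationary (C : numClosedFieldType) n (A : 'M[C]_n)
    (v : 'cV[C]_n) :
  exists g, krylov A v g == krylov A v g.+1.
Proof.
case: (boolP [exists g : 'I_n.+1, krylov A v g == krylov A v g.+1]).
  by case/existsP=> g gP; exists g.
rewrite negb_exists => /forallP ns.
have dimK k : (k <= n.+1)%N -> (k <= \dim (krylov A v k))%N.
  elim: k => [//|k IHk] lt_kn.
  apply: leq_ltn_trans (IHk (ltnW lt_kn)) _.
  have sK : (krylov A v k <= krylov A v k.+1)%VS.
    apply: sub_span => x /mapP[j]; rewrite mem_iota => /andP[_ lt_jk] ->.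
    by apply/mapP; exists j; rewrite // mem_iota add0n in lt_jk *; apply: ltnW.
  rewrite ltn_neqAle dimvS // andbT (dimv_leqif_eq sK).
  exact: ns (Ordinal lt_kn).
have := leq_trans (dimK _ (leqnn _)) (dimvS (subvf _)).
by rewrite dimvf /dim /= muln1 ltnn.
Qed.

Definition grade (C : numClosedFieldType) n (A : 'M[C]_n) (v : 'cV[C]_n) : nat :=
  ex_minn (krylov_stationary A v).

Definition krylov1 (C : numClosedFieldType) n1 n2 (A : 'M[C]_(n1 + n2))
    (v : 'cV[C]_(n1 + n2)) (k : nat) : {vspace 'cV[C]_n1} :=
  (linfun (@usubmx C n1 n2 1) @: krylov A v k)%VS.

Definition krylov2 (C : numClosedFieldType) n1 n2 (A : 'M[C]_(n1 + n2))
    (v : 'cV[C]_(n1 + n2)) (k : nat) : {vspace 'cV[C]_n2} :=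
  (linfun (@dsubmx C n1 n2 1) @: krylov A v k)%VS.

Definition in_krylovX (C : numClosedFieldType) n1 n2 (A : 'M[C]_(n1 + n2))
    (v : 'cV[C]_(n1 + n2)) (k : nat) : {pred 'cV[C]_(n1 + n2)} :=
  [pred x | (usubmx x \in krylov1 A v k) && (dsubmx x \in krylov2 A v k)].

Definition orthonormal_basis_mx (C : numClosedFieldType) m
    (U : {vspace 'cV[C]_m}) (V : 'M[C]_(m, \dim U)) : Prop :=
  basis_of U [seq col j V | j <- enum 'I_(\dim U)] /\ V ^t* *m V = 1%:M.

Definition qfom_mx (C : numClosedFieldType) n1 n2 d1 d2 (A : 'M[C]_(n1 + n2))
    (V1 : 'M[C]_(n1, d1)) (V2 : 'M[C]_(n2, d2)) : 'M[C]_(d1 + d2) :=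
  (block_mx V1 0 0 V2) ^t* *m A *m block_mx V1 0 0 V2.

(* The Galerkin conditions alone; nonsingularity of [qfom_mx] is stated
   separately wherever existence of the iterate is meant. *)
Definition is_qfom_iterate (C : numClosedFieldType) n1 n2
    (A : 'M[C]_(n1 + n2)) (b x0 : 'cV[C]_(n1 + n2)) (k : nat)
    (x : 'cV[C]_(n1 + n2)) : Prop :=
  let r0 := b - A *m x0 in
  x - x0 \in in_krylovX A r0 k /\
  (forall y, y \in in_krylovX A r0 k -> y ^t* *m (b - A *m x) = 0).

(* Main.v *)
(* At the grade [g], [A] maps K^(g) onto itself, so A^-1 r0 already lies in
   K^(g), which is contained in its product space: A^-1 b satisfies the Galerkin
   conditions, and these have a single solution when H is nonsingular. Isometries
   V_1, V_2 carry unit vectors to unit vectors, hence W^2(H) is part of W^2(A).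
   Finally, a null vector of H yields w <> 0 in the product space with A w
   orthogonal to that space. If x_i is a unit vector with w_i in span(x_i) and x_i
   orthogonal to (A w)_i, then the coordinates of w on (x_1, x_2) form a null
   vector of the compression of A to (x_1, x_2), so that 0 is in W^2(A). *)
Require Import Defs.
From HB Require Import structures.
From mathcomp Require Import all_boot all_order all_algebra.
From mathcomp Require Import complex.
From mathcomp Require Import classical_sets reals.

Set Implicit Arguments.
Unset Strict Implicit.
Unset Printing Implicit Defensive.

Import Order.TTheory GRing.Theory Num.Theory.

Local Open Scope classical_set_scope.
Local Open Scope ring_scope.
Local Open Scope sesquilinear_scope.

(** * Null vectors and singular matrices *)

Lemma eigenvalue_singular (F : fieldType) m (M : 'M[F]_m) (c : 'cV[F]_m) :
  c != 0 -> M *m c = 0 -> eigenvalue M 0.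
Proof.
move=> c0 Mc0; have: M \notin unitmx.
  by apply: contra c0 => uM; rewrite -(mulKmx uM c) Mc0 mulmx0.
(* [eigenvalue] refers to row vectors, so the determinant serves to trade the null column for a null
   row. *)
rewrite unitmxE unitfE negbK => /det0P[v v0 vM].
by apply/eigenvalueP; exists v; rewrite // vM scale0r.
Qed.

Lemma unitmx_injective (F : fieldType) m (M : 'M[F]_m) :
  (forall c : 'cV_m, M *m c = 0 -> c = 0) -> M \in unitmx.
Proof.
move=> injM; rewrite -unitmx_tr unitmxE unitfE; apply/det0P => -[v v0 vM].
move/negP: v0; apply; rewrite -(inj_eq trmx_inj) trmx0; apply/eqP/injM.
by apply: trmx_inj; rewrite trmx_mul trmxK vM trmx0.
Qed.

(** * Adjoints, the Euclidean norm and unit vectors *)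

Section Adjoint.
Variable C : numClosedFieldType.

Lemma adjmxM m n p (A : 'M[C]_(m, n)) (B : 'M[C]_(n, p)) :
  (A *m B) ^t* = B ^t* *m A ^t*.
Proof. by rewrite trmx_mul map_mxM. Qed.

Lemma adjmxZ m n a (A : 'M[C]_(m, n)) : (a *: A) ^t* = a^* *: A ^t*.
Proof. by apply/matrixP=> i j; rewrite !mxE rmorphM. Qed.

Lemma enorm_ge0 m (x : 'cV[C]_m) : 0 <= enorm x.
Proof. by rewrite sqrtC_ge0 sumr_ge0 // => i _; rewrite exprn_ge0. Qed.

Lemma gram_cV m (x : 'cV[C]_m) : x ^t* *m x = (enorm x ^+ 2)%:M.
Proof.
apply/matrixP=> i j; rewrite !ord1 sqrtCK !mxE eqxx mulr1n.
by apply: eq_bigr => k _; rewrite !mxE normCK mulrC.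
Qed.

Lemma enorm1P m (x : 'cV[C]_m) : enorm x = 1 <-> x ^t* *m x = 1%:M.
Proof.
rewrite gram_cV; split=> [->|]; first by rewrite expr1n.
move/matrixP/(_ 0 0); rewrite !mxE eqxx !mulr1n => /eqP.
by rewrite sqrp_eq1 ?enorm_ge0 // => /eqP.
Qed.

Lemma enorm_eq0 m (x : 'cV[C]_m) : (enorm x == 0) = (x == 0).
Proof.
rewrite sqrtC_eq0 psumr_eq0 => [|i _]; last exact: exprn_ge0.
apply/allP/eqP => [x0|-> i _]; last by rewrite mxE normr0 expr0n eqxx.
apply/matrixP=> i j; rewrite ord1 mxE; apply/eqP.
by have /implyP/(_ isT) := x0 i (mem_index_enum i); rewrite expf_eq0 normr_eq0.
Qed.

Lemma enorm_normalize m (x : 'cV[C]_m) :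
  x != 0 -> enorm ((enorm x)^-1 *: x) = 1.
Proof.
rewrite -enorm_eq0 => x0; apply/enorm1P.
rewrite adjmxZ -scalemxAl -scalemxAr gram_cV scalerA /=.
rewrite geC0_conj ?invr_ge0 ?enorm_ge0 // scale_scalar_mx -expr2 exprVn.
by rewrite mulVf // expf_neq0.
Qed.

Lemma unit_orthogonal m (a : 'cV[C]_m) :
  (1 < m)%N -> exists2 x : 'cV[C]_m, enorm x = 1 & x ^t* *m a = 0.
Proof.
(* The left kernel of the single column [a] has rank at least m - 1 > 0; adjoints of its rows are
   orthogonal to [a]. *)
move=> m_gt1; have : kermx a != 0.
  rewrite -mxrank_eq0 mxrank_ker subn_eq0 -ltnNge.
  exact: leq_ltn_trans (rank_leq_col a) m_gt1.
rewrite -nz_row_eq0; set u := nz_row _ => u0.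
have ua : u *m a = 0 by apply/sub_kermxP/nz_row_sub.
have x0 : u ^t* != 0.
  by apply: contra u0 => /eqP ux; rewrite -[u]trmxCK ux trmx0 map_mx0.
exists ((enorm (u ^t*))^-1 *: u ^t*); first exact: enorm_normalize.
by rewrite adjmxZ trmxCK -scalemxAl ua scaler0.
Qed.

(* The three cases [w <> 0], [w = 0 <> U] and [w = 0 = U] take [x] to be,
   respectively, [w] normalized, any unit vector of [U], and a unit vector
   orthogonal to [a]; only the last one needs room in the ambient space. *)
Lemma unit_direction m (U : {vspace 'cV[C]_m}) (w a : 'cV[C]_m) :
    (0 < m)%N -> (m = 1%N -> (0 < \dim U)%N) ->
    w \in U -> (forall u, u \in U -> u ^t* *m a = 0) ->
  exists x : 'cV[C]_m,
    [/\ enorm x = 1, exists c, w = c *: x & x ^t* *m a = 0].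
Proof.
move=> m_gt0 m1 wU aU.
have normalizeU u : u \in U -> u != 0 ->
    let x := (enorm u)^-1 *: u in enorm x = 1 /\ x ^t* *m a = 0.
  by move=> uU u0; split; [exact: enorm_normalize | apply/aU/memvZ].
have [w0|w0] := eqVneq w 0; last first.
  have [x1 xa] := normalizeU w wU w0; exists ((enorm w)^-1 *: w); split=> //.
  by exists (enorm w); rewrite scalerA divff ?enorm_eq0 // scale1r.
have [U0|U0] := eqVneq U 0%VS; last first.
  have pick0 : vpick U != 0 by rewrite vpick0.
  have [x1 xa] := normalizeU _ (memv_pick U) pick0.
  exists ((enorm (vpick U))^-1 *: vpick U); split=> //.
  by exists 0; rewrite scale0r.
have m_gt1 : (1 < m)%N.
  rewrite ltn_neqAle m_gt0 andbT; apply/eqP => m1E.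
  by have := m1 (esym m1E); rewrite U0 dimv0.
have [x x1 xa] := unit_orthogonal a m_gt1.
by exists x; split=> //; exists 0; rewrite scale0r.
Qed.

End Adjoint.

(** * The quadratic numerical range and its compressions *)

Section QuadraticNumericalRange.
Variables (C : numClosedFieldType) (n1 n2 : nat) (A : 'M[C]_(n1 + n2)).

(** Since w = diag(x1, x2) (c1, c2), applying the compression to (c1, c2) yields the products of x1,
    x2 with the two blocks of A w, which vanish. *)
Lemma qnr0_null_vector (w : 'cV[C]_(n1 + n2)) x1 x2 c1 c2 :
    w != 0 -> enorm x1 = 1 -> enorm x2 = 1 ->
    usubmx w = c1 *: x1 -> dsubmx w = c2 *: x2 ->
    x1 ^t* *m usubmx (A *m w) = 0 -> x2 ^t* *m dsubmx (A *m w) = 0 ->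
  qnr A 0.
Proof.
move=> w0 x11 x21 w1 w2 Aw1 Aw2; exists x1, x2; split=> //.
have wE : w = col_mx (x1 *m c1%:M) (x2 *m c2%:M).
  by rewrite !mul_mx_scalar -w1 -w2 vsubmxK.
apply: (@eigenvalue_singular _ _ _ (col_mx c1%:M c2%:M)).
  apply: contra w0 => /eqP; rewrite -[X in _ = X]col_mx0 => /eq_col_mx[c10 c20].
  by rewrite wE c10 c20 !mulmx0 col_mx0.
move: Aw1 Aw2; rewrite wE -{1 2}[A]submxK mul_block_col col_mxKu col_mxKd.
rewrite !mulmxDr !mulmxA => Aw1 Aw2.
by rewrite /compress2 mul_block_col Aw1 Aw2 col_mx0.
Qed.

Section Compression.
Variables (d1 d2 : nat) (V1 : 'M[C]_(n1, d1)) (V2 : 'M[C]_(n2, d2)).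

Lemma qfom_mxE : qfom_mx A V1 V2 =
  block_mx (V1 ^t* *m ulsubmx A *m V1) (V1 ^t* *m ursubmx A *m V2)
           (V2 ^t* *m dlsubmx A *m V1) (V2 ^t* *m drsubmx A *m V2).
Proof.
rewrite /qfom_mx -{1}[A]submxK tr_block_mx map_block_mx !trmx0 !map_mx0.
by rewrite !mulmx_block !mul0mx !mulmx0 !addr0 !add0r.
Qed.

(** The compression of H to (y1, y2) is literally the compression of A to (V1 y1, V2 y2), and
    isometries preserve unit norm. *)
Lemma qnr_qfom_mx : V1 ^t* *m V1 = 1%:M -> V2 ^t* *m V2 = 1%:M ->
  qnr (qfom_mx A V1 V2) `<=` qnr A.
Proof.
move=> V11 V21 z [y1 [y2 [/enorm1P y11 /enorm1P y21 zP]]].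
exists (V1 *m y1), (V2 *m y2); split.
- by apply/enorm1P; rewrite adjmxM mulmxA -(mulmxA _ _ V1) V11 mulmx1.
- by apply/enorm1P; rewrite adjmxM mulmxA -(mulmxA _ _ V2) V21 mulmx1.
move: zP; rewrite /compress2 qfom_mxE block_mxKul block_mxKur.
by rewrite block_mxKdl block_mxKdr !adjmxM !mulmxA.
Qed.

End Compression.
End QuadraticNumericalRange.

(** * Krylov spaces at the grade *)

Section Krylov.
Variables (C : numClosedFieldType) (n : nat) (A : 'M[C]_n) (v : 'cV[C]_n).

Lemma krylov_gradeS : krylov A v (grade A v).+1 = krylov A v (grade A v).
Proof. by rewrite /grade; case: ex_minnP => g /eqP. Qed.

(* [A] is injective and maps the Krylov space of level [grade] into itself,
   hence onto itself, so [v] itself is the image of one of its vectors. *)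
Lemma invmx_krylov : A \in unitmx -> invmx A *m v \in krylov A v (grade A v).
Proof.
move=> uA; set K := krylov A v _.
pose f := linfun (mulmx A : 'cV[C]_n -> 'cV[C]_n).
have fK : (f @: K <= K)%VS.
  (* Only the target is raised to level [grade] + 1, which makes room for the shifted generators
     A^(i+1) v. *)
  rewrite {2}/K -krylov_gradeS /K {1}/krylov limg_span.
  apply: sub_span => _ /mapP[_ /mapP[i + ->] ->].
  rewrite mem_iota add0n => lt_i; apply/mapP; exists i.+1.
    by rewrite mem_iota add0n ltnS.
  by rewrite lfunE /= mulmxA exprS.
have injf : (lker f == 0)%VS.
  by apply/lker0P => x y; rewrite !lfunE /=; apply: (can_inj (mulKmx uA)).
have fKE : (f @: K)%VS = K.
  by apply/eqP; rewrite -(dimv_leqif_eq fK) limg_dim_eq // (eqP injf) capv0.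
have: v \in K.
  (* Level [grade] + 1 lists the generator [v] even when the grade is 0. *)
  rewrite /K -krylov_gradeS; apply/memv_span/mapP; exists 0%N => //.
  by rewrite expr0 mul1mx.
by rewrite -{1}fKE => /memv_imgP[u uK ->]; rewrite lfunE /= mulKmx.
Qed.

End Krylov.

(** * The product Krylov space in orthonormal coordinates *)

Lemma mem_orthonormal_basis_mx (C : numClosedFieldType) m
    (U : {vspace 'cV[C]_m}) (V : 'M[C]_(m, \dim U)) (y : 'cV[C]_m) :
  orthonormal_basis_mx V -> reflect (exists c, y = V *m c) (y \in U).
Proof.
case=> /span_basis spanV _.
have VcE (c : 'cV_(\dim U)) : V *m c = \sum_j c j 0 *: col j V.
  apply/matrixP=> i k; rewrite ord1 mxE summxE.
  by apply: eq_bigr => j _; rewrite !mxE mulrC.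
pose X := [tuple col j V | j < \dim U].
have memU z : (z \in U) = (z \in <<X>>%VS) by rewrite spanV.
rewrite memU; apply: (iffP idP) => [/coord_span yE|[c ->]]; last first.
  rewrite VcE; apply: memv_suml => j _; apply/memvZ/memv_span.
  by apply/mapP; exists j; rewrite ?mem_enum.
exists (\col_j coord X j y).
rewrite VcE {1}yE; apply: eq_bigr => j _.
by rewrite mxE -tnth_nth tnth_mktuple.
Qed.

Section Iterates.
Variables (C : numClosedFieldType) (n1 n2 : nat) (A : 'M[C]_(n1 + n2)).
Variables (v : 'cV[C]_(n1 + n2)) (k : nat).
Variables (V1 : 'M[C]_(n1, \dim (krylov1 A v k))).
Variables (V2 : 'M[C]_(n2, \dim (krylov2 A v k))).
Hypotheses (V1P : orthonormal_basis_mx V1) (V2P : orthonormal_basis_mx V2).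

Let V := block_mx V1 0 0 V2.

Lemma in_krylovXP y : reflect (exists c, y = V *m c) (y \in in_krylovX A v k).
Proof.
rewrite inE; apply: (iffP andP).
  case=> /(mem_orthonormal_basis_mx _ V1P)[c1 y1].
  move=> /(mem_orthonormal_basis_mx _ V2P)[c2 y2].
  exists (col_mx c1 c2); rewrite -[y]vsubmxK y1 y2 mul_block_col.
  by rewrite !mul0mx addr0 add0r.
case=> c ->; rewrite -[c]vsubmxK mul_block_col col_mxKu col_mxKd.
rewrite !mul0mx addr0 add0r; split.
  by apply/(mem_orthonormal_basis_mx _ V1P); eexists.
by apply/(mem_orthonormal_basis_mx _ V2P); eexists.
Qed.

Lemma in_krylovX_orthogonal (a : 'cV_(n1 + n2)) :
  (forall y, y \in in_krylovX A v k -> y ^t* *m a = 0) <-> V ^t* *m a = 0.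
Proof.
split=> [aK|aV y /in_krylovXP[c ->]]; last by rewrite adjmxM -mulmxA aV mulmx0.
apply/eqP; rewrite -enorm_eq0 -sqrf_eq0; apply/eqP.
(* Testing [a] against its own projection gives the squared norm of [V ^t* *m a]. *)
have /aK : V *m (V ^t* *m a) \in in_krylovX A v k by apply/in_krylovXP; eexists.
rewrite adjmxM -mulmxA gram_cV => /matrixP/(_ 0 0).
by rewrite !mxE eqxx mulr1n.
Qed.

Lemma adj_diag_mul : V ^t* *m V = 1%:M.
Proof.
have [[_ V11] [_ V21]] := (V1P, V2P).
rewrite tr_block_mx map_block_mx !trmx0 !map_mx0 mulmx_block.
by rewrite !mul0mx !mulmx0 !addr0 !add0r V11 V21 -scalar_mx_block.
Qed.

End Iterates.

(** * Galerkin conditions and existence of the iterates *)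

Lemma is_qfom_iterateE (C : numClosedFieldType) n1 n2 (A : 'M[C]_(n1 + n2))
    (b x0 : 'cV[C]_(n1 + n2)) (r0 := b - A *m x0) k
    (V1 : 'M[C]_(n1, \dim (krylov1 A r0 k)))
    (V2 : 'M[C]_(n2, \dim (krylov2 A r0 k))) (V := block_mx V1 0 0 V2) x :
    orthonormal_basis_mx V1 -> orthonormal_basis_mx V2 ->
    qfom_mx A V1 V2 \in unitmx ->
  is_qfom_iterate A b x0 k x <->
  x = x0 + V *m (invmx (qfom_mx A V1 V2) *m (V ^t* *m r0)).
Proof.
move=> V1P V2P uH.
(* In coordinates, orthogonality of the residual is the linear system [H c = V ^t* r0]. *)
have residualE c : V ^t* *m (b - A *m (x0 + V *m c)) =
    V ^t* *m r0 - qfom_mx A V1 V2 *m c.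
  by rewrite [A *m (_ + _)]mulmxDr opprD addrA mulmxBr /qfom_mx !mulmxA.
rewrite /is_qfom_iterate -/r0; split=> [[/(in_krylovXP V1P V2P)[c xc]]|->].
  move/(in_krylovX_orthogonal V1P V2P); rewrite -(subrKC x0 x) xc residualE.
  by move/subr0_eq ->; rewrite mulKmx.
split; first by apply/(in_krylovXP V1P V2P); eexists; rewrite addrC addKr.
by apply/(in_krylovX_orthogonal V1P V2P); rewrite residualE mulKVmx ?subrr.
Qed.

(** The correction A^-1 b - x0 equals A^-1 r0, and the zero residual is orthogonal to everything. *)
Lemma exact_is_qfom_iterate (C : numClosedFieldType) n1 n2
    (A : 'M[C]_(n1 + n2)) (b x0 : 'cV[C]_(n1 + n2)) k :
    A \in unitmx ->
    invmx A *m (b - A *m x0) \in in_krylovX A (b - A *m x0) k ->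
  is_qfom_iterate A b x0 k (invmx A *m b).
Proof.
move=> uA; rewrite mulmxBr mulKmx // => Kx.
by split=> // y _; rewrite mulKVmx // subrr mulmx0.
Qed.

Lemma qfom_mx_unit (C : numClosedFieldType) n1 n2 (A : 'M[C]_(n1 + n2)) v k
    (V1 : 'M[C]_(n1, \dim (krylov1 A v k)))
    (V2 : 'M[C]_(n2, \dim (krylov2 A v k))) :
    (0 < n1)%N -> (0 < n2)%N ->
    (n1 = 1%N -> (0 < \dim (krylov1 A v k))%N) ->
    (n2 = 1%N -> (0 < \dim (krylov2 A v k))%N) ->
    orthonormal_basis_mx V1 -> orthonormal_basis_mx V2 ->
  ~ qnr A 0 -> qfom_mx A V1 V2 \in unitmx.
Proof.
move=> n1_gt0 n2_gt0 d1 d2 V1P V2P nA0; apply: unitmx_injective => c Hc0.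
apply/eqP/negPn/negP => c0; apply: nA0.
set V := block_mx V1 0 0 V2; pose w := V *m c.
have w0 : w != 0.
  apply: contra c0 => /eqP Vc0.
  by rewrite -[c]mul1mx -(adj_diag_mul V1P V2P) -mulmxA -/V -/w Vc0 mulmx0.
have /andP[w1 w2] : w \in in_krylovX A v k.
  by apply/(in_krylovXP V1P V2P); exists c.
have Aw y : y \in in_krylovX A v k -> y ^t* *m (A *m w) = 0.
  by move: y; apply/(in_krylovX_orthogonal V1P V2P); rewrite !mulmxA.
(* Padding [u] by a zero block stays in the product space, so orthogonality splits into one
   condition per block. *)
have Aw1 u : u \in krylov1 A v k -> u ^t* *m usubmx (A *m w) = 0.
  move=> uK; have := Aw (col_mx u 0).
  rewrite inE col_mxKu col_mxKd uK mem0v -[A *m w]vsubmxK tr_col_mx map_row_mx.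
  by rewrite trmx0 map_mx0 mul_row_col mul0mx addr0 vsubmxK => /(_ isT).
have Aw2 u : u \in krylov2 A v k -> u ^t* *m dsubmx (A *m w) = 0.
  move=> uK; have := Aw (col_mx 0 u).
  rewrite inE col_mxKu col_mxKd uK mem0v -[A *m w]vsubmxK tr_col_mx map_row_mx.
  by rewrite trmx0 map_mx0 mul_row_col mul0mx add0r vsubmxK => /(_ isT).
have [x1 [x11 [c1 wc1] Ax1]] := unit_direction n1_gt0 d1 w1 Aw1.
have [x2 [x21 [c2 wc2] Ax2]] := unit_direction n2_gt0 d2 w2 Aw2.
exact: qnr0_null_vector w0 x11 x21 wc1 wc2 Ax1 Ax2.
Qed.

(* The side conditions of the last item only exclude levels k at which a block
   of size n_i = 1 of A is matched by an empty block (dimension 0) of the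
   compressed matrix: there the 2 x 2 block structure degenerates and the claim
   fails, e.g. for A = [0 1; 1 0], n1 = n2 = 1, r0 = (0, 1)^T and k = 1. *)
Theorem theorem3p5 (R : realType) (n1 n2 : nat)
    (hn1 : (1 <= n1)%N) (hn2 : (1 <= n2)%N)
    (A : 'M[R[i]]_(n1 + n2)) (hA : A \in unitmx)
    (b x0 r0 : 'cV[R[i]]_(n1 + n2)) (hr0 : r0 = b - A *m x0) :
  exists kmax : nat,
    [/\ (* (i) *)
        [/\ (kmax <= grade A r0)%N,
            invmx A *m r0 \in in_krylovX A r0 kmax
          & forall (V1 : 'M[R[i]]_(n1, \dim (krylov1 A r0 kmax)))
                   (V2 : 'M[R[i]]_(n2, \dim (krylov2 A r0 kmax))),
              orthonormal_basis_mx V1 -> orthonormal_basis_mx V2 ->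
              qfom_mx A V1 V2 \in unitmx ->
              forall x, is_qfom_iterate A b x0 kmax x <-> x = invmx A *m b],
        (* (ii) *)
        forall k, (1 <= k <= kmax)%N ->
          forall (V1 : 'M[R[i]]_(n1, \dim (krylov1 A r0 k)))
                 (V2 : 'M[R[i]]_(n2, \dim (krylov2 A r0 k))),
            orthonormal_basis_mx V1 -> orthonormal_basis_mx V2 ->
            qnr (qfom_mx A V1 V2) `<=` qnr A
      & (* (iii) *)
        ~ qnr A 0 ->
        forall k, (1 <= k <= kmax)%N ->
          (n1 = 1%N -> (1 <= \dim (krylov1 A r0 k))%N) ->
          (n2 = 1%N -> (1 <= \dim (krylov2 A r0 k))%N) ->
          forall (V1 : 'M[R[i]]_(n1, \dim (krylov1 A r0 k)))
                 (V2 : 'M[R[i]]_(n2, \dim (krylov2 A r0 k))),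
            orthonormal_basis_mx V1 -> orthonormal_basis_mx V2 ->
            qfom_mx A V1 V2 \in unitmx /\
            (exists! x, is_qfom_iterate A b x0 k x)].
Proof.
subst r0; exists (grade A (b - A *m x0)).
have Kr := invmx_krylov (b - A *m x0) hA.
have KXr : invmx A *m (b - A *m x0) \in
    in_krylovX A (b - A *m x0) (grade A (b - A *m x0)).
  rewrite inE; apply/andP; split; apply/memv_imgP; eexists; try exact: Kr.
    by rewrite lfunE.
  by rewrite lfunE.
split.
- split=> // V1 V2 V1P V2P uH x; have xE := is_qfom_iterateE _ V1P V2P uH.
  (* A^-1 b is an iterate too, hence equal to the closed form that characterizes every iterate. *)
  by rewrite xE; have /xE <- := exact_is_qfom_iterate hA KXr.
- by move=> k _ V1 V2 [_ V1P] [_ V2P]; apply: qnr_qfom_mx.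
move=> nA0 k _ d1 d2 V1 V2 V1P V2P.
have uH := qfom_mx_unit hn1 hn2 d1 d2 V1P V2P nA0; split=> //.
eexists; split; first by apply/(is_qfom_iterateE _ V1P V2P uH).
by move=> x /(is_qfom_iterateE _ V1P V2P uH).
Qed.
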